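(* Each $\aleph_0$-space possesses a binary countable closed $k$-network and hence is super.
   Context: A family $\mathcal N$ of subsets of a topological space $X$ is called: a $k$-network if for any open set $U\subset X$ and any compact set $K\subset U$ there exists a finite subfamily $\mathcal F\subset\mathcal N$ such that $K\subset\bigcup\mathcal F\subset U$; a closed $k$-network if it is a $k$-network and each $N\in\mathcal N$ is closed in $X$; linked if $A\cap B\neq\emptyset$ for any $A,B\in\mathcal N$; centered if $\bigcap\mathcal F\ne\emptyset$ for every finite nonempty subfamily $\mathcal F\subset\mathcal N$; binary if every linked subfamily of $\mathcal N$ is centered. A topological space is super if it possesses a binary closed $k$-network. A regular (Hausdorff) topological space is an $\aleph_0$-space if it possesses a countable $k$-network. *)

(* Defs.v *)
From mathcomp Require Import all_boot all_order.
From mathcomp Require Import all_classical all_reals all_analysis.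

Set Implicit Arguments.
Unset Strict Implicit.
Unset Printing Implicit Defensive.

Local Open Scope classical_set_scope.

Definition k_network (X : topologicalType) (N : set (set X)) : Prop :=
  forall U K : set X, open U -> compact K -> K `<=` U ->
    exists F : set (set X),
      [/\ finite_set F, F `<=` N,
          K `<=` \bigcup_(A in F) A & \bigcup_(A in F) A `<=` U].

Definition closed_k_network (X : topologicalType) (N : set (set X)) : Prop :=
  k_network N /\ (forall A : set X, N A -> closed A).

(* [A] and [B] may coincide, so all members of a linked family are nonempty. *)
Definition linked (X : Type) (N : set (set X)) : Prop :=
  forall A B : set X, N A -> N B -> A `&` B !=set0.

Definition centered (X : Type) (N : set (set X)) : Prop :=
  forall F : set (set X), finite_set F -> F !=set0 -> F `<=` N ->
    \bigcap_(A in F) A !=set0.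

Definition binary (X : Type) (N : set (set X)) : Prop :=
  forall L : set (set X), L `<=` N -> linked L -> centered L.

Definition super (X : topologicalType) : Prop :=
  exists N : set (set X), closed_k_network N /\ binary N.

(* Regular spaces are Hausdorff by convention, while the library's
   [regular_space] does not include any separation of points; [countable]
   allows finite families. *)
Definition aleph0_space (X : topologicalType) : Prop :=
  [/\ regular_space X, hausdorff_space X &
      exists N : set (set X), countable N /\ k_network N].

(* Main.v *)
Require Import Defs.
From mathcomp Require Import all_boot all_order finmap.
From mathcomp Require Import all_classical all_reals all_analysis.

Set Implicit Arguments.
Unset Strict Implicit.
Unset Printing Implicit Defensive.

Local Open Scope classical_set_scope.

(** Let [N] be a countable k-network of the regular Hausdorff space [X].  Then
    [X] is normal, and the closures of the members of [N] form a countable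
    family of closed sets [E n].  A binary family is built by enlarging a finite
    binary family of closed sets once for each [n], in such a way that [E n]
    becomes a finite union of members ([binary_extension]).  The union of the
    stages is binary, because being binary only concerns finite subfamilies, and
    it is a k-network, because by normality a compact [K] inside an open [U] has
    a neighbourhood whose closure lies in [U], so that the closures of the
    finitely many members of [N] that serve [K] and this neighbourhood lie in
    [U] as well.

    The heart is one such step.  Let [m i] be a finite binary family of closed
    sets and [A] a closed set.  The trace of [x] is the set of the indices [i]
    with [m i x], and the points of [A] with a given trace form a stratum.  The
    closed sets to be added are indexed by the traces [S] that occur in [A], and
    have these properties:
    - all points of the set of index [S] have their trace included in [S], so
      that this set only meets the [m i] with [i] in [S];
    - two of the sets can only meet when their indices are comparable.
    Both are achieved by normality, treating the strata in order of decreasing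
    trace and cutting off a thin closed neighbourhood of each
    ([adapted_extend]).  In a linked family made of such sets and of some
    [m i], the indices [S] then form a chain [C], with a least element [T], and
    all the [i] belong to [T].  So it suffices to have, for each chain [C], a
    point of trace [T] in all the sets whose index belongs to [C], and such a
    point can simply be added to these sets.  The comparability of the indices
    survives if different chains use different points.

    This needs as many points in the stratum of [T] as there are chains.  The
    points of the finite strata are therefore first added to the family as
    singletons, which never harms binarity; afterwards every stratum is either
    infinite or a point whose singleton belongs to the family, and the latter
    is no obstacle since its trace is maximal ([binary_cover]). *)

(** * Traces and strata *)

(** A form of normality that only speaks of closed sets, the complements of
    [P'] and [Q'] being the disjoint neighbourhoods of [Q] and [P]. *)
Definition closed_splitting (X : topologicalType) : Prop :=
  forall P Q : set X, closed P -> closed Q -> P `&` Q = set0 ->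
    exists P' Q' : set X, [/\ closed P', closed Q', P' `|` Q' = setT,
      P' `&` Q = set0 & Q' `&` P = set0].

Lemma infinite_injection (X : topologicalType) (J : finType) (B : set X) :
  infinite_set B -> exists q : J -> X, injective q /\ forall j, B (q j).
Proof.
move=> Binf; have [x0 _] := infinite_setN0 Binf.
have [F FB Fcard] := infinite_set_fset #|J| Binf.
pose s := finmap.enum_fset F.
have ltF (j : J) : (enum_rank j < size s)%N.
  by rewrite (leq_trans (ltn_ord _)).
exists (fun j => nth x0 s (enum_rank j)); split.
  move=> i j /eqP; rewrite nth_uniq ?finmap.fset_uniq// => /eqP/val_inj.
  exact: enum_rank_inj.
by move=> j; apply: FB; exact: mem_nth.
Qed.

Section Strata.
Variables (X : topologicalType) (I : finType) (m : I -> set X).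

Definition trace (x : X) : {set I} := finset (fun i => x \in m i).

Lemma in_trace x i : (i \in trace x) <-> m i x.
Proof. by rewrite inE in_setE. Qed.

Definition strata (A : set X) : {set {set I}} :=
  finset (fun S => `[< exists2 x, A x & trace x = S >]).

Lemma in_strata A S : S \in strata A <-> exists2 x, A x & trace x = S.
Proof. by rewrite inE; split=> /asboolP. Qed.

Definition comparable (S T : {set I}) : bool := (S \subset T) || (T \subset S).

Lemma comparableC S T : comparable S T = comparable T S.
Proof. by rewrite /comparable orbC. Qed.

(** [P] is the finite set of points that will be distributed among the sets
    [G S] later on; the last clause ensures that this leaves the sets [G S]
    comparable whenever they meet. *)
Definition adapted (P : set X) (G : {set I} -> set X) : Prop :=
  [/\ forall S, closed (G S),
      forall S x, G S x -> trace x \subset S,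
      forall S T x, G S x -> G T x -> comparable S T
    & forall S x, P x -> G S x -> trace x = S].

Hypotheses (Xsplit : closed_splitting X) (Xacc : accessible_space X).
Hypothesis mcl : forall i, closed (m i).

(** Induction on the number of strata of the part [R] still to be covered.  A
    stratum of [R] whose trace [S] is maximal is closed, since having all of [S]
    in one's trace is a closed condition.  Normality cuts [R] into a piece
    around this stratum, which joins the set of index [S], and a closed rest
    that misses it and hence has fewer strata. *)
Lemma adapted_extend (P : set X) (n : nat) (R : set X) (G : {set I} -> set X) :
  finite_set P -> closed R -> adapted P G -> (#|strata R| <= n)%N ->
  exists G', [/\ adapted P G', forall S, G S `<=` G' S,
    forall x, R x -> exists S, G' S x
    & forall S x, G' S x -> G S x \/ R x /\ S \in strata R].
Proof.
move=> Pfin; elim: n R G => [|n IHn] R G Rcl Gad Rn.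
  exists G; split=> // [S x //|x Rx|S x Gx]; last by left.
  suff : trace x \in strata R.
    by move: Rn; rewrite leqn0 cards_eq0 => /eqP ->; rewrite inE.
  by apply/in_strata; exists x.
have [R0|] := eqVneq (strata R) finset.set0.
  by apply: IHn => //; rewrite R0 cards0.
case/finset.set0Pn => S0 S0R.
have [S SR Smax] : exists2 S, S \in strata R &
    forall x, R x -> S \subset trace x -> trace x = S.
  case: (arg_maxnP (fun S : {set I} => #|S|) S0R) => S SR Smax.
  exists S => // x Rx Sx; apply/esym/eqP; rewrite eqEcard Sx.
  by apply: Smax; apply/in_strata; exists x.
have [Gcl Gtr Gcmp GP] := Gad.
(* [K] is the stratum of trace [S], and [Q] is what the piece cut off around
   [K] has to avoid for the family to remain adapted. *)
pose K := R `&` \bigcap_(i in [set` S]) m i.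
pose Q := \bigcup_(i in [set` (~: S)%SET]) m i `|` (P `&` [set x | trace x <> S])
  `|` \bigcup_(T in [set` finset (fun T : {set I} => ~~ (S \subset T))]) G T.
have Kcl : closed K by apply: closedI => //; exact: closed_bigI.
have Qcl : closed Q.
  apply: closedU; last by apply: closed_bigcup.
  apply: closedU; first by apply: closed_bigcup.
  by apply: accessible_finite_set_closed.1 => //; exact: finite_setIl.
have Ktr x : K x -> trace x = S.
  case=> Rx Sx; apply: Smax => //; apply/fintype.subsetP => i iS.
  by apply/in_trace; exact: Sx.
have KQ : K `&` Q = set0.
  rewrite -subset0 => x [Kx]; have xS := Ktr x Kx.
  case=> [[[i]|[_]]|[T]] /=.
  - by rewrite inE -xS => /negP iNx /in_trace.
  - by [].
  - by rewrite inE => /negP ST /Gtr; rewrite xS.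
have [K' [Q' [K'cl Q'cl KQT K'Q Q'K]]] := Xsplit Kcl Qcl KQ.
pose H T := if T == S then G S `|` (R `&` K') else G T.
have HE T x : H T x <-> G T x \/ [/\ T = S, R x & K' x].
  rewrite /H; case: eqP => [->|TS]; last by split=> [|[|[]]//]; left.
  by split=> [[?|[]]|[?|[]]]; [left|right|left|right].
have NQ x : K' x -> ~ Q x.
  by move=> K'x Qx; have : (K' `&` Q) x by []; rewrite K'Q.
have Hnew T x : G T x -> K' x -> S \subset T.
  move=> GT /NQ xQ; apply: contra_notT xQ => ST.
  by right; exists T => //=; rewrite inE.
have Had : adapted P H.
  split.
  - move=> T; rewrite /H; case: eqP => // _.
    by apply: closedU => //; apply: closedI.
  - move=> T x /HE [/Gtr//|[-> Rx /NQ xQ]]; apply/fintype.subsetP => i /in_trace ix.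
    by apply: contra_notT xQ => iS; do 2 left; exists i => //=; rewrite inE.
  - move=> T U x /HE [GT|[-> Rx K'x]] /HE [GU|[-> _ K''x]].
    + exact: Gcmp GT GU.
    + by rewrite /comparable (Hnew _ _ GT K''x) orbT.
    + by rewrite /comparable (Hnew _ _ GU K'x).
    + by rewrite /comparable subxx.
  - move=> T x Px /HE [/GP->//|[-> Rx /NQ xQ]].
    by apply: contra_notP xQ => xS; left; right.
have R'cl : closed (R `&` Q') by exact: closedI.
have sub' : {subset strata (R `&` Q') <= strata R}.
  by move=> T /in_strata[x [Rx _] xT]; apply/in_strata; exists x.
have R'n : (#|strata (R `&` Q')| <= n)%N.
  rewrite -ltnS (leq_trans _ Rn)//; apply: proper_card.
  apply/properP; split; first exact/fintype.subsetP.
  exists S => //; apply/negP => /in_strata[x [Rx Q'x] xS].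
  have : (Q' `&` K) x.
    by split=> //; split=> // i /=; rewrite -xS => /in_trace.
  by rewrite Q'K.
have [G' [G'ad HG' G'cov G'sub]] := IHn _ _ R'cl Had R'n.
exists G'; split=> //.
- by move=> T x GT; apply: HG'; apply/HE; left.
- move=> x Rx; have : (K' `|` Q') x by rewrite KQT.
  case=> [K'x|Q'x]; last exact: G'cov.
  by exists S; apply: HG'; apply/HE; right.
- move=> T x /G'sub [/HE[?|[-> Rx _]]|[[Rx _] /sub' ?]].
  + by left.
  + by right.
  + by right.
Qed.

Definition chain (C : {set {set I}}) : Prop :=
  forall S T, S \in C -> T \in C -> comparable S T.

(** In an infinite stratum the points attached to the sets [C] of traces can be
    chosen pairwise distinct; otherwise the stratum is a point [x] with a set
    [m i] reduced to [x], and [x] serves for all [C].  The point [a] only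
    provides a default value. *)
Lemma chain_points (a : X) (A : set X) :
  (forall x, A x -> (exists i, m i = [set x]) \/
     infinite_set (A `&` [set y | trace y = trace x])) ->
  exists p : {set I} -> {set {set I}} -> X,
    forall T, T \in strata A -> forall C,
      [/\ A (p T C), trace (p T C) = T
        & forall C', p T C = p T C' -> C = C' \/ exists i, m i = [set p T C]].
Proof.
move=> Ainf.
have /choice[p pP] : forall T, exists q : {set {set I}} -> X,
    T \in strata A -> forall C,
      [/\ A (q C), trace (q C) = T
        & forall C', q C = q C' -> C = C' \/ exists i, m i = [set q C]].
  move=> T; have [/in_strata[x Ax xT]|TA] := boolP (T \in strata A).
    have [[i mi]|/(infinite_injection {set {set I}})[q [qinj qA]]] := Ainf x Ax.
      by exists (fun=> x) => _ C; split=> // C' _; right; exists i.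
    exists q => _ C; have [? qx] := qA C; split=> //; first by rewrite qx.
    by move=> C' /qinj; left.
  by exists (fun=> a).
by exists p.
Qed.

(** The sets of index [S] delivered by [adapted_extend], to which the points of
    the chains through [S] have been added, are those required. *)
Lemma binary_cover (A : set X) :
  binary (range m) -> closed A ->
  (forall x, A x -> (exists i, m i = [set x]) \/
     infinite_set (A `&` [set y | trace y = trace x])) ->
  exists G : set (set X), [/\ finite_set G, forall D, G D -> closed D,
    \bigcup_(D in G) D = A & binary (range m `|` G)].
Proof.
move=> mbin Acl Ainf.
have [->|/set0P[a Aa]] := eqVneq A set0.
  exists set0; split=> //; first by rewrite bigcup_set0.
  by rewrite setU0.
have [p pP] := chain_points a Ainf.
pose P := range (fun TC : {set I} * {set {set I}} => p TC.1 TC.2).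
have Pfin : finite_set P by apply: finite_image; exact: finite_finset.
have [|G [[Gcl Gtr Gcmp GP] _ Gcov Gsub]] :=
    @adapted_extend P #|strata A| A (fun=> set0) Pfin Acl _ (leqnn _).
  by split=> // S; exact: closed0.
pose pts S := [set x | exists T C, [/\ T \in strata A, x = p T C, S \in C,
  chain C & forall U, U \in C -> T \subset U]].
have ptsP S : pts S `<=` P.
  by move=> _ [T [C [_ -> _ _ _]]]; exists (T, C).
pose H S := G S `|` pts S.
have Htr S x : H S x -> trace x \subset S.
  case=> [/Gtr//|[T [C [TA -> SC _ TC]]]].
  by have [_ -> _] := pP T TA C; exact: TC.
(* Adding the points keeps meeting sets comparable.  A point shared by [G U]
   and [pts V] has trace [U], which is the least element of a chain through [V];
   a point shared by [pts S] and [pts T] determines its chain, unless it forms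
   a stratum whose trace is maximal. *)
have Hcmp S T x : S \in strata A -> T \in strata A -> H S x -> H T x ->
    comparable S T.
  have mixed U V y : G U y -> pts V y -> comparable U V.
    move=> GU Vy; have := GP _ _ (ptsP _ _ Vy) GU.
    case: Vy => W [C [WA -> VC _ WC]]; have [_ -> _] := pP W WA C => <-.
    by rewrite /comparable WC.
  move=> SA TA [GS|pS] [GT|pT]; first exact: Gcmp GS GT.
  - exact: mixed GS pT.
  - by rewrite comparableC; exact: mixed GT pS.
  move: pS pT => [U [C [UA -> SC Cch UC]]] [V [C' [VA eqp TC' _ VC']]].
  have [_ tU pU] := pP U UA C; have [_ tV _] := pP V VA C'.
  have UV : U = V by rewrite -tU -tV eqp.
  subst V; have [CC'|[i mi]] := pU _ eqp.
    by apply: Cch => //; rewrite CC'.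
  have US : U = S.
    have iU : i \in U by rewrite -tU; apply/in_trace; rewrite mi.
    move: SA => /in_strata[y _ yS].
    have : m i y by apply/in_trace; rewrite yS (fintype.subsetP (UC _ SC)).
    by rewrite mi => /= yp; rewrite -yS yp tU.
  by rewrite -US /comparable VC'.
have HA S : S \in strata A -> H S `<=` A.
  move=> SA x [/Gsub[//|[]//]|[T [C [TA -> _ _ _]]]].
  by have [] := pP T TA C.
exists (H @` [set` strata A]); split.
- by apply: finite_image; exact: finite_finset.
- move=> _ [S _ <-]; apply: closedU => //.
  apply: accessible_finite_set_closed.1 => //.
  exact: sub_finite_set (ptsP S) Pfin.
- apply/seteqP; split=> x; first by case=> _ [S SA <-]; exact: HA.
  move=> /Gcov[S GS]; have [//|[_ SA]] := Gsub _ _ GS.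
  by exists (H S); [exists S|left].
move=> L LmH Llink F Ffin F0 FL.
pose C := finset (fun S => (S \in strata A) && (H S \in L)).
have CP S : S \in C <-> S \in strata A /\ L (H S).
  by rewrite inE; split=> [/andP[-> /set_mem]|[-> /mem_set]].
have [C0|] := eqVneq C finset.set0.
  apply: (mbin L) => // D LD; have [//|[S SA HD]] := LmH _ LD.
  suff : S \in C by rewrite C0 inE.
  by apply/CP; rewrite HD.
case/finset.set0Pn => S0 S0C.
have Cch : chain C.
  move=> S T /CP[SA LS] /CP[TA LT]; have [x [HS HT]] := Llink _ _ LS LT.
  exact: Hcmp HS HT.
(* The indices occurring in [L] form a chain, and the point attached to it lies
   in all members of [L]. *)
have [T TC Tmin] : exists2 T, T \in C & forall S, S \in C -> T \subset S.
  case: (arg_minnP (fun S : {set I} => #|S|) S0C) => T TC Tmin.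
  exists T => // S SC; have /orP[//|ST] := Cch T S TC SC.
  by have /eqP -> : S == T by rewrite eqEcard ST Tmin.
have [TA LT] := (CP T).1 TC; have [_ pT _] := pP T TA C.
exists (p T C) => D /FL LD; have [[i _ iD]|[S SA HD]] := LmH _ LD.
  have [y []] := Llink _ _ LD LT; rewrite -iD => iy /Htr/fintype.subsetP yT.
  by apply/in_trace; rewrite pT; apply: yT; apply/in_trace.
by rewrite -HD; right; exists T, C; split=> //; apply/CP; rewrite HD.
Qed.
End Strata.

(** * Binary families of closed sets *)

(** The singletons of the points of [A] in finite strata are added to [M] before
    applying [binary_cover].  The other strata are unchanged, as these singletons
    do not meet them. *)
Lemma binary_extension (X : topologicalType) (M : set (set X)) (A : set X) :
  closed_splitting X -> accessible_space X ->
  finite_set M -> (forall D, M D -> closed D) -> binary M -> closed A ->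
  exists M', [/\ finite_set M', forall D, M' D -> closed D, binary M',
    M `<=` M' & exists2 G, G `<=` M' & \bigcup_(D in G) D = A].
Proof.
move=> Xsplit Xacc Mfin Mcl Mbin Acl.
pose old_trace := trace (fun i : fset_set M => val i).
pose B := A `&` [set x | finite_set (A `&` [set y | old_trace y = old_trace x])].
have Bfin : finite_set B.
  pose W S := [set x | B x /\ old_trace x = S].
  apply: (@sub_finite_set _ _ (\bigcup_(S in setT) W S)).
    by move=> x Bx; exists (old_trace x).
  apply: bigcup_finite => [|S _]; first exact: finite_finset.
  have [->|/set0P[x [[Ax xfin] xS]]] := eqVneq (W S) set0 => //.
  by apply: sub_finite_set xfin => y [[Ay _] yS]; split=> //=; rewrite yS.
pose M1 := M `|` [set [set x] | x in B].
have M1fin : finite_set M1 by rewrite finite_setU; split=> //; exact: finite_image.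
have M1cl D : M1 D -> closed D.
  by case=> [/Mcl//|[x _ <-]]; exact: accessible_closed_set1.
have M1bin : binary M1.
  move=> L LM Llink F Ffin F0 FL.
  have [[x Lx]|noL] := pselect (exists x, L [set x]).
    by exists x => D /FL LD; have [y [->]] := Llink _ _ Lx LD.
  apply: (Mbin L) => // D LD; have [//|[x _ xD]] := LM _ LD.
  by case: noL; exists x; rewrite xD.
pose m (i : fset_set M1) : set X := val i.
have mE : range m = M1.
  apply/seteqP; split=> [_ [i _ <-]|D MD].
    by have := valP i; rewrite in_fset_set// => /set_mem.
  have Di : D \in fset_set M1 by rewrite in_fset_set// mem_set.
  by exists [` Di]%fset.
have mcl i : closed (m i) by apply: M1cl; rewrite -mE; exists i.
have mbin : binary (range m) by rewrite mE.
have Ainf x : A x -> (exists i, m i = [set x]) \/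
    infinite_set (A `&` [set y | trace m y = trace m x]).
  move=> Ax; have [Bx|Bx] := pselect (B x).
    left; have : range m [set x] by rewrite mE; right; exists x.
    by case=> i _ <-; exists i.
  (* Traces are compared for two families: [old_trace] for [M], and [trace m]
     for [M1]; they carry the same information outside [B]. *)
  right; suff : infinite_set (A `&` [set y | old_trace y = old_trace x]).
    apply: sub_infinite_set => y [Ay yx]; split=> //=.
    have By : ~ B y by move=> [_ /=]; rewrite yx => xfin; exact: Bx.
    have notB z i : m i z -> ~ B z -> M (m i).
      move=> iz Bz; have : range m (m i) by exists i.
      by rewrite mE => -[//|[b bB bi]]; move: iz; rewrite -bi /= => zb; rewrite zb in Bz.
    have old_traceP z i (Mi : m i \in fset_set M) :
        ([` Mi]%fset \in old_trace z) <-> m i z by exact: in_trace.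
    have MS i : M (m i) -> m i \in fset_set M by move=> ?; rewrite in_fset_set// mem_set.
    apply/setP => i; apply/idP/idP => /in_trace iz; apply/in_trace.
      by have Mi := MS _ (notB _ _ iz By); apply/(old_traceP _ _ Mi); rewrite -yx; apply/old_traceP.
    by have Mi := MS _ (notB _ _ iz Bx); apply/(old_traceP _ _ Mi); rewrite yx; apply/old_traceP.
  by move=> xfin; exact: Bx.
have [G [Gfin Gcl GA Gbin]] := binary_cover Xsplit Xacc mcl mbin Acl Ainf.
exists (M1 `|` G); split.
- by rewrite finite_setU.
- by move=> D [/M1cl|/Gcl].
- by rewrite -mE.
- by move=> D MD; left; left.
- by exists G => // D GD; right.
Qed.

(** [binary_extension] is applied to one [E n] after the other, starting from
    the empty family.  A finite part of the union of the increasing stages lies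
    in a single stage, so that binarity passes to the union. *)
Lemma binary_refinement (X : topologicalType) (E : nat -> set X) :
  closed_splitting X -> accessible_space X -> (forall n, closed (E n)) ->
  exists M, [/\ countable M, forall D, M D -> closed D, binary M
    & forall n, exists G, [/\ finite_set G, G `<=` M & \bigcup_(D in G) D = E n]].
Proof.
move=> Xsplit Xacc Ecl.
pose ok (M : set (set X)) :=
  [/\ finite_set M, forall D, M D -> closed D & binary M].
have /choice[next nextP] : forall nM : nat * set (set X), exists M', ok nM.2 ->
    [/\ ok M', nM.2 `<=` M' & exists2 G, G `<=` M' & \bigcup_(D in G) D = E nM.1].
  case=> n M /=; have [[Mfin Mcl Mbin]|notok] := pselect (ok M); last by exists set0.
  have [M' [? ? ? ? ?]] := binary_extension Xsplit Xacc Mfin Mcl Mbin (Ecl n).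
  by exists M'.
pose stage := fix stage n := if n is k.+1 then next (k, stage k) else set0.
have stage_ok n : ok (stage n).
  elim: n => [|n /(nextP (n, stage n))[]//].
  split=> // L L0 _ F _ [D FD] FL; have : L D by exact: FL.
  by move=> /L0.
have stageS n := nextP (n, stage n) (stage_ok n).
have stage_mono k n : (k <= n)%N -> stage k `<=` stage n.
  elim: n => [|n IHn]; first by rewrite leqn0 => /eqP ->.
  rewrite leq_eqVlt => /predU1P[->//|/IHn kn]; apply: (subset_trans kn).
  by have [] := stageS n.
exists (\bigcup_n stage n); split.
- by apply: bigcup_countable => // n _; apply: finite_set_countable; have [] := stage_ok n.
- by move=> D [n _]; have [_ + _] := stage_ok n; exact.
- move=> L LM Llink F Ffin F0 FL.
  suff [n Fn] : exists n, F `<=` stage n.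
    have [_ _ /(_ F Fn)] := stage_ok n; apply=> //.
    by move=> A B /FL LA /FL LB; exact: Llink.
  have /choice[r rP] : forall D, exists n, F D -> stage n D.
    move=> D; have [/FL/LM[n _ Dn]|] := pselect (F D); first by exists n.
    by exists 0%N.
  exists (\max_(D <- fset_set F) r D)%N => D FD.
  apply: (stage_mono (r D)); last exact: rP.
  by apply: leq_bigmax_seq => //; rewrite in_fset_set// mem_set.
- move=> n; have [_ _ [G Gs GE]] := stageS n.
  exists G; split=> //.
    by have [sfin _ _] := stage_ok n.+1; exact: sub_finite_set Gs sfin.
  by move=> D /Gs; exists n.+1.
Qed.

(** * Normality from a countable k-network *)

Lemma countable_range (T : Type) (N : set (set T)) :
  countable N -> exists E : nat -> set T, N `<=` range E.
Proof.
move=> /countable_injP[f finj].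
exists (fun n => xget set0 [set D | N D /\ f D = n]) => D ND.
exists (f D) => //; case: xgetP => [D' _ [ND' eqf]|/(_ D)]; last by case.
by apply: finj; rewrite ?inE.
Qed.

(** A point outside [Q] lies in a member of the network included in an open set
    whose closure misses [Q]; as one such open set for each member of the
    network is enough, countably many suffice. *)
Lemma countable_cover_setC (X : topologicalType) (N : set (set X)) (Q : set X) :
  regular_space X -> countable N -> k_network N -> closed Q ->
  exists U : nat -> set X, [/\ forall n, open (U n),
    forall n x, closure (U n) x -> ~ Q x & ~` Q `<=` \bigcup_n U n].
Proof.
move=> Xreg /countable_range[E NE] Nk Qcl.
pose good (W : set X) := open W /\ forall x, closure W x -> ~ Q x.
have /choice[U UP] : forall n, exists U, good U /\
    ((exists2 W, good W & E n `<=` W) -> E n `<=` U).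
  move=> n; have [[W Wgood EW]|noW] := pselect (exists2 W, good W & E n `<=` W).
    by exists W.
  by exists set0; split; [split; [exact: open0|rewrite closure0]|].
exists U; split=> [n|n|x Qx]; [by have [[]] := UP n|by have [[]] := UP n|].
have [W [V [Wo Vo Wx QV WV0]]] := (regular_openP x).1 (Xreg x) _ Qcl Qx.
have Wgood : good W.
  split=> // y Wy Qy; have [z Wz] := Wy _ (open_nbhs_nbhs (conj Vo (QV _ Qy))).
  by move: Wz; rewrite WV0.
have [|F [_ FN Fx FW]] := Nk W [set x] Wo (@compact_set1 _ x); first by move=> _ ->.
have [D FD Dx] := Fx x erefl; have [n _ En] := NE _ (FN _ FD).
exists n => //; apply: (UP n).2; last by rewrite En.
by exists W => //; rewrite En => y Dy; apply: FW; exists D.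
Qed.

(** The classical proof that regular Lindelof spaces are normal: from the n-th
    set of each of two countable open covers, remove the closures of the first n
    sets of the other one. *)
Lemma regular_k_network_splitting (X : topologicalType) (N : set (set X)) :
  regular_space X -> countable N -> k_network N -> closed_splitting X.
Proof.
move=> Xreg Nc Nk P Q Pcl Qcl PQ0.
have [U [Uo UQ Ucov]] := countable_cover_setC Xreg Nc Nk Qcl.
have [V [Vo VP Vcov]] := countable_cover_setC Xreg Nc Nk Pcl.
pose shrink (A B : nat -> set X) := \bigcup_n
  (A n `&` ~` (\bigcup_(k in `I_n.+1) closure (B k))).
have shrink_open A B : (forall n, open (A n)) -> open (shrink A B).
  move=> Ao; apply: bigcup_open => n _; apply: openI => //.
  by apply: closed_openC; apply: closed_bigcup => // k _; exact: closed_closure.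
have shrink_disj A B x : shrink A B x -> ~ shrink B A x.
  move=> [n _ [An nB]] [k _ [Bk nA]]; have [kn|nk] := leqP k n.
    by apply: nB; exists k => //; exact: subset_closure.
  by apply: nA; exists n; [exact: ltnW|exact: subset_closure].
exists (~` shrink V U), (~` shrink U V); split.
- by apply: open_closedC; exact: shrink_open.
- by apply: open_closedC; exact: shrink_open.
- rewrite -setCI -subTset => x _ [VUx]; exact: shrink_disj.
- rewrite -subset0 => x [nx Qx]; apply: nx.
  have [n _ Vn] : (\bigcup_n V n) x.
    by apply: Vcov => Px; have : (P `&` Q) x by []; rewrite PQ0.
  by exists n => //; split=> // -[k _ /UQ].
- rewrite -subset0 => x [nx Px]; apply: nx.
  have [n _ Un] : (\bigcup_n U n) x.
    by apply: Ucov => Qx; have : (P `&` Q) x by []; rewrite PQ0.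
  by exists n => //; split=> // -[k _ /VP].
Qed.

(** * The theorem *)

Theorem corollary1 (X : topologicalType) (hX : aleph0_space X) :
  (exists N : set (set X),
     [/\ binary N, countable N & closed_k_network N]) /\ super X.
Proof.
suff [N [Nbin Nc Nk]] : exists N : set (set X),
    [/\ binary N, countable N & closed_k_network N].
  by split; exists N.
have [Xreg Xhaus [N [Nc Nk]]] := hX.
have Xsplit := regular_k_network_splitting Xreg Nc Nk.
have Xacc := hausdorff_accessible Xhaus.
have [E NE] := countable_range Nc.
have [M [Mc Mcl Mbin Mref]] := binary_refinement Xsplit Xacc
  (fun n => @closed_closure _ (E n)).
exists M; split=> //; split=> // U K Uo Kc KU.
have Kcl := compact_closed Xhaus Kc.
(* [~` Q] is a neighbourhood of [K] whose closure, being included in [P],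
   lies in [U]. *)
have [P [Q [Pcl Qcl PQT PU QK]]] : exists P Q : set X,
    [/\ closed P, closed Q, P `|` Q = setT, P `&` ~` U = set0 & Q `&` K = set0].
  by apply: Xsplit => //; [exact: open_closedC|by apply/disjoints_subset; rewrite setCK].
have [|F [Ffin FN KF FQ]] := Nk (~` Q) K (closed_openC Qcl) Kc.
  by apply/disjoints_subset; rewrite setIC.
have /choice[G GP] : forall D, exists G, F D ->
    [/\ finite_set G, G `<=` M & \bigcup_(B in G) B = closure D].
  move=> D; have [/FN/NE[n _ En]|] := pselect (F D); last by exists set0.
  by have [G GP] := Mref n; exists G; rewrite -En.
exists (\bigcup_(D in F) G D); split.
- by apply: bigcup_finite => // D /GP[].
- by move=> B [D /GP[_ + _]]; exact.
- move=> x /KF[D FD Dx]; have [_ _ GD] := GP D FD.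
  have : closure D x by exact: subset_closure.
  by rewrite -GD => -[B GB Bx]; exists B => //; exists D.
- move=> x [B [D FD GB] Bx]; have [_ _ GD] := GP D FD.
  have Dx : closure D x by rewrite -GD; exists B.
  have DP : D `<=` P.
    move=> y Dy; have : (P `|` Q) y by rewrite PQT.
    by case=> // Qy; have : (~` Q) y by apply: FQ; exists D.
  have Px : P x by apply: Pcl; exact: closureS DP _ Dx.
  by apply: contrapT => Ux; have : (P `&` ~` U) x by []; rewrite PU.
Qed.
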